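(* Let $(V,\Delta,\beta)$ be a Hom-coalgebra over $\mathbb{K}$, and let $\Delta_L=\Delta-\Delta^{op}$. Then $$\mathbf{c}_\beta(\Delta_L)+\Phi_{(213)}\circ\mathbf{c}_\beta(\Delta_L)+\Phi_{(231)}\circ\mathbf{c}_\beta(\Delta_L)=2\sum_{\sigma\in\mathcal{S}_3}(-1)^{\epsilon(\sigma)}\,\Phi_\sigma\circ\mathbf{c}_\beta(\Delta),$$ where $(-1)^{\epsilon(\sigma)}$ is the signature of the permutation $\sigma$.
   Context: $\mathbb{K}$ is an algebraically closed field of characteristic $0$. A Hom-coalgebra is a triple $(V,\Delta,\beta)$ where $V$ is a $\mathbb{K}$-vector space and $\Delta:V\to V\otimes V$, $\beta:V\to V$ are linear maps (no coassociativity or Hom-coassociativity is assumed). $\Delta^{op}=\tau\circ\Delta$, where $\tau(x\otimes y)=y\otimes x$ is the flip. For a linear map $D:V\to V\otimes V$, the $\beta$-coassociator of $D$ is the linear map $\mathbf{c}_\beta(D):V\to V^{\otimes 3}$, $\mathbf{c}_\beta(D)=(D\otimes\beta)\circ D-(\beta\otimes D)\circ D$. $\mathcal{S}_3$ is the symmetric group on $\{1,2,3\}$; for $\sigma\in\mathcal{S}_3$, $\Phi_\sigma:V^{\otimes 3}\to V^{\otimes 3}$ is the linear map $\Phi_\sigma(x_1\otimes x_2\otimes x_3)=x_{\sigma^{-1}(1)}\otimes x_{\sigma^{-1}(2)}\otimes x_{\sigma^{-1}(3)}$. Here $(213)$ and $(231)$ denote, in cycle notation, the two cyclic permutations of order 3: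 $2\mapsto1\mapsto3\mapsto2$ and $2\mapsto3\mapsto1\mapsto2$ respectively. *)

(* Defs.v *)
From HB Require Import structures.
From mathcomp Require Import all_fingroup all_boot all_algebra.
From mathcomp Require Import boolp.
From mathcomp Require Import freeg.

Set Implicit Arguments.
Unset Strict Implicit.
Unset Printing Implicit Defensive.

Import GRing.Theory.

Local Open Scope ring_scope.
Local Open Scope quotient_scope.

(* The tensor product of two vector spaces is the quotient of the free vector *)
(* space on U * V by the subspace spanned by the bilinearity relations.       *)

Section FreeLift.
Variables (K : fieldType) (T : choiceType) (M : lmodType K) (f : T -> M).

Lemma fglift_sum (D : {freeg T / K}) :
  fglift f D = \sum_(x <- dom D) coeff x D *: f x.
Proof. by rewrite -{1}[D]Freeg_dom fglift_Freeg /prelift big_map. Qed.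

Lemma fglift_widen (s : seq T) (D : {freeg T / K}) :
    uniq s -> {subset dom D <= s} ->
  fglift f D = \sum_(x <- s) coeff x D *: f x.
Proof.
move=> us sub; rewrite fglift_sum.
rewrite [RHS](bigID (fun x => x \in dom D)) /= [X in _ + X]big1 ?addr0; last first.
  by move=> x xD; rewrite coeff_outdom // scale0r.
rewrite -[RHS]big_filter; apply/perm_big/uniq_perm; rewrite ?uniq_dom ?filter_uniq //.
by move=> x; rewrite mem_filter; case xD: (x \in dom D) => //=; rewrite sub.
Qed.

Lemma fglift_linear : linear (fglift f : {freeg T / K} -> M).
Proof.
move=> a D E; pose s := undup (dom D ++ dom E ++ dom (a *: D + E)).
have us : uniq s := undup_uniq _.
have sD : {subset dom D <= s} by move=> x xD; rewrite mem_undup !mem_cat xD.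
have sE : {subset dom E <= s} by move=> x xE; rewrite mem_undup !mem_cat xE orbT.
have sF : {subset dom (a *: D + E) <= s}.
  by move=> x xF; rewrite mem_undup !mem_cat xF !orbT.
rewrite !(@fglift_widen s) // scaler_sumr -big_split; apply: eq_bigr => x _ /=.
by rewrite coeffD coeffZ scalerDl scalerA.
Qed.

End FreeLift.

Section TensorProduct.
Variables (K : fieldType) (U V : lmodType K).

Local Notation free := {freeg (U * V)%type / K}.
Local Notation gen u v := (<< 1 *g (u, v) >> : free).

Inductive tensor_rel : free -> Prop :=
| TensorRel0 : tensor_rel 0
| TensorRelLin a r s : tensor_rel r -> tensor_rel s -> tensor_rel (a *: r + s)
| TensorRelL a u u' v :
    tensor_rel (gen (a *: u + u') v - (a *: gen u v + gen u' v))
| TensorRelR a u v v' :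
    tensor_rel (gen u (a *: v + v') - (a *: gen u v + gen u v')).

Definition tensor_relb : {pred free} := [pred D | `[< tensor_rel D >]].

Fact tensor_relb_zmod_closed : zmod_closed tensor_relb.
Proof.
split=> [|x y]; rewrite !inE; first by apply/asboolP; exact: TensorRel0.
move=> /asboolP xR /asboolP yR; apply/asboolP.
by rewrite addrC -scaleN1r; apply: TensorRelLin.
Qed.
HB.instance Definition _ := GRing.isZmodClosed.Build free tensor_relb
  tensor_relb_zmod_closed.

Definition tensor : Type := Quotient.quot tensor_relb.

HB.instance Definition _ := GRing.Zmodule.on tensor.
HB.instance Definition _ := Quotient.on tensor.

Local Notation pi := (\pi_tensor : free -> tensor).

Fact tensor_piP (x y : free) : pi x = pi y <-> tensor_rel (x - y).
Proof.
rewrite (rwP (asboolP (tensor_rel (x - y)))) (rwP eqP).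
by rewrite -[_ == _]Quotient.idealrBE inE.
Qed.

Fact tensor_piD : {morph pi : x y / x + y}.
Proof. exact: Quotient.pi_add. Qed.

Fact tensor_pi0 : pi 0 = 0.
Proof. by apply: (addrI (pi 0)); rewrite -tensor_piD !addr0. Qed.

Definition tensor_scale (a : K) (t : tensor) : tensor := pi (a *: repr t).

Fact tensor_piZ a x : tensor_scale a (pi x) = pi (a *: x).
Proof.
apply/tensor_piP; rewrite -scalerBr -[_ *: _]addr0.
by apply: TensorRelLin TensorRel0; apply/tensor_piP; rewrite reprK.
Qed.

Fact tensor_scaleA a b t :
  tensor_scale a (tensor_scale b t) = tensor_scale (a * b) t.
Proof. by rewrite -[t]reprK (tensor_piZ b) !tensor_piZ scalerA. Qed.

Fact tensor_scale1 : left_id 1 tensor_scale.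
Proof. by move=> t; rewrite -[t]reprK tensor_piZ scale1r. Qed.

Fact tensor_scaleDr : right_distributive tensor_scale +%R.
Proof.
move=> a t1 t2; rewrite -[t1]reprK -[t2]reprK -tensor_piD !tensor_piZ.
by rewrite scalerDr tensor_piD.
Qed.

Fact tensor_scaleDl t : {morph tensor_scale^~ t : a b / a + b}.
Proof.
by move=> a b /=; rewrite -[t]reprK !tensor_piZ scalerDl tensor_piD.
Qed.

HB.instance Definition _ := GRing.Zmodule_isLmodule.Build K tensor
  tensor_scaleA tensor_scale1 tensor_scaleDr tensor_scaleDl.

Definition tens (u : U) (v : V) : tensor := pi (gen u v).

Lemma tens_is_bilinear : bilinear_for *:%R *:%R tens.
Proof.
split=> [v a u u'|u a v v'] /=.
  rewrite [a *: tens _ _]tensor_piZ -tensor_piD.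
  apply/tensor_piP; exact: TensorRelL.
rewrite [a *: tens _ _]tensor_piZ -tensor_piD.
apply/tensor_piP; exact: TensorRelR.
Qed.
HB.instance Definition _ :=
  bilinear_isBilinear.Build K U V tensor *:%R *:%R tens tens_is_bilinear.

(* Only meaningful when f is bilinear; see tlift_tens and tlift_linear. *)
Definition tlift (M : lmodType K) (f : U -> V -> M) (t : tensor) : M :=
  fglift (fun p => f p.1 p.2) (repr t).

Section Universal.
Variables (M : lmodType K) (f : U -> V -> M).
Hypothesis fP : bilinear_for *:%R *:%R f.

Let F : free -> M := fglift (fun p => f p.1 p.2).

Let F_additive (D E : free) a : F (a *: D + E) = a *: F D + F E.
Proof. exact: fglift_linear. Qed.

Let F_rel D : tensor_rel D -> F D = 0.
Proof.
have FB x y : F (x - y) = F x - F y.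
  by rewrite [x - y]addrC -[- y]scaleN1r F_additive scaleN1r addrC.
have Fgen u v : F (gen u v) = f u v by rewrite /F liftU scale1r.
elim=> [|a r s _ Fr _ Fs|a u u' v|a u v v'].
- by rewrite -[0](subrr 0) FB subrr.
- by rewrite F_additive Fr Fs scaler0 addr0.
- by rewrite FB F_additive !Fgen; have /= -> := fP.1 v; rewrite subrr.
- by rewrite FB F_additive !Fgen; have /= -> := fP.2 u; rewrite subrr.
Qed.

Let tlift_pi D : tlift f (pi D) = F D.
Proof.
have /F_rel : tensor_rel (repr (pi D) - D) by apply/tensor_piP; rewrite reprK.
rewrite addrC -scaleN1r F_additive scaleN1r addrC => /eqP.
by rewrite subr_eq0 => /eqP.
Qed.

Lemma tlift_tens u v : tlift f (tens u v) = f u v.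
Proof. by rewrite tlift_pi /F liftU scale1r. Qed.

Lemma tlift_linear : linear (tlift f).
Proof.
move=> a t1 t2; rewrite -[t1]reprK -[t2]reprK.
rewrite [a *: pi _]tensor_piZ -tensor_piD.
by rewrite !tlift_pi F_additive.
Qed.

End Universal.

Lemma tensor_ind (P : tensor -> Prop) :
    P 0 -> (forall a u v t, P t -> P (a *: tens u v + t)) ->
  forall t, P t.
Proof.
move=> P0 PD t; rewrite -[t]reprK -[repr t]Freeg_dom.
elim: [seq _ | _ <- _] => [|[a [u v]] s IHs].
  by rewrite freeg_nil tensor_pi0; exact: P0.
rewrite -cat1s freeg_cat.
have -> : [freeg [:: (a, (u, v))]] = a *: gen u v.
  by apply/eqP/freeg_eqP => x; rewrite coeffZ !coeffU mul1r.
by rewrite tensor_piD -tensor_piZ; apply: PD.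
Qed.

Lemma tensor_ext (M : lmodType K) (g h : {linear tensor -> M}) :
  (forall u v, g (tens u v) = h (tens u v)) -> g =1 h.
Proof.
move=> gh; elim/tensor_ind => [|a u v t IHt]; first by rewrite !linear0.
by rewrite !linearP /= gh IHt.
Qed.

End TensorProduct.

Arguments tensor {K} (U V)%_type_scope.

Notation "U ⊗ V" := (tensor U V) (at level 40, left associativity) : type_scope.
Notation "u ⊗ v" := (tens u v) (at level 40, left associativity) : ring_scope.

Section TensorMaps.
Variable K : fieldType.
Implicit Types U V W : lmodType K.

Lemma tlift_eq U V (M : lmodType K) (f g : U -> V -> M) :
  (forall u v, f u v = g u v) -> tlift f =1 tlift g.
Proof.
by move=> fg t; congr (tlift _ t); apply/funext => u; apply/funext.
Qed.

Definition tflip U V : U ⊗ V -> V ⊗ U := tlift (fun u v => v ⊗ u).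

Fact tflip_bilinear U V :
  bilinear_for *:%R *:%R (fun (u : U) (v : V) => v ⊗ u).
Proof. by split=> [v a u u'|u a v v'] /=; [rewrite linearPr | rewrite linearPl]. Qed.

HB.instance Definition _ U V :=
  GRing.isLinear.Build K (U ⊗ V)%type (V ⊗ U)%type *:%R
  (@tflip U V) (tlift_linear (@tflip_bilinear U V)).

Lemma tflip_tens U V (u : U) (v : V) : tflip (u ⊗ v) = v ⊗ u.
Proof. exact: (tlift_tens (@tflip_bilinear U V)). Qed.

Section Map.
Variables (U V U' V' : lmodType K).
Variables (f : {linear U -> U'}) (g : {linear V -> V'}).

Definition tmap : U ⊗ V -> U' ⊗ V' := tlift (fun u v => f u ⊗ g v).

Fact tmap_bilinear : bilinear_for *:%R *:%R (fun u v => f u ⊗ g v).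
Proof.
by split=> [v a u u'|u a v v'] /=; rewrite linearP ?linearPl ?linearPr.
Qed.

HB.instance Definition _ :=
  GRing.isLinear.Build K (U ⊗ V)%type (U' ⊗ V')%type *:%R
  tmap (tlift_linear tmap_bilinear).

Lemma tmap_tens u v : tmap (u ⊗ v) = f u ⊗ g v.
Proof. exact: (tlift_tens tmap_bilinear). Qed.

End Map.

Section TripleLift.
Variables (U V W M : lmodType K) (f : U -> V -> W -> M).

Definition tlift3l : U ⊗ V ⊗ W -> M :=
  tlift (fun p w => tlift (fun u v => f u v w) p).

Definition tlift3r : U ⊗ (V ⊗ W) -> M :=
  tlift (fun u p => tlift (fun v w => f u v w) p).

Hypothesis f1 : forall v w, linear (fun u => f u v w).
Hypothesis f2 : forall u w, linear (fun v => f u v w).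
Hypothesis f3 : forall u v, linear (fun w => f u v w).

Let fl w : bilinear_for *:%R *:%R (fun u v => f u v w).
Proof. by split=> [v|u]; [exact: f1 | exact: f2]. Qed.

Let fr u : bilinear_for *:%R *:%R (fun v w => f u v w).
Proof. by split=> [w|v]; [exact: f2 | exact: f3]. Qed.

Let bl : bilinear_for *:%R *:%R (fun p w => tlift (fun u v => f u v w) p).
Proof.
split=> [w|p a w w'] /=; first exact: tlift_linear (fl w).
elim/tensor_ind: p => [|b u v t IHt].
  have t0 x : tlift (fun u v => f u v x) 0 = 0.
    by rewrite -[0](subrr 0) -scaleN1r addrC (tlift_linear (fl x)) scaleN1r addNr.
  by rewrite !t0 scaler0 addr0.
rewrite !(tlift_linear (fl _)) !(tlift_tens (fl _)) IHt f3.
by rewrite !scalerDr !scalerA [b * a]mulrC addrACA.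
Qed.

Let br : bilinear_for *:%R *:%R (fun u p => tlift (fun v w => f u v w) p).
Proof.
split=> [p a u u'|u] /=; last exact: tlift_linear (fr u).
elim/tensor_ind: p => [|b v w t IHt].
  have t0 x : tlift (fun v w => f x v w) 0 = 0.
    by rewrite -[0](subrr 0) -scaleN1r addrC (tlift_linear (fr x)) scaleN1r addNr.
  by rewrite !t0 scaler0 addr0.
rewrite !(tlift_linear (fr _)) !(tlift_tens (fr _)) IHt f1.
by rewrite !scalerDr !scalerA [b * a]mulrC addrACA.
Qed.

Lemma tlift3l_linear : linear tlift3l.
Proof. exact: tlift_linear bl. Qed.

Lemma tlift3l_tens u v w : tlift3l (u ⊗ v ⊗ w) = f u v w.
Proof. by rewrite /tlift3l (tlift_tens bl) (tlift_tens (fl w)). Qed.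

Lemma tlift3r_linear : linear tlift3r.
Proof. exact: tlift_linear br. Qed.

Lemma tlift3r_tens u v w : tlift3r (u ⊗ (v ⊗ w)) = f u v w.
Proof. by rewrite /tlift3r (tlift_tens br) (tlift_tens (fr u)). Qed.

End TripleLift.

(* The canonical isomorphism through which V ⊗ (V ⊗ V) is identified with     *)
(* V^{⊗3}, taken here to be (V ⊗ V) ⊗ V.                                      *)
Definition tassoc U V W : U ⊗ (V ⊗ W) -> U ⊗ V ⊗ W :=
  tlift3r (fun u v w => u ⊗ v ⊗ w).

Fact tassoc_linear U V W : linear (@tassoc U V W).
Proof.
by apply: tlift3r_linear => [v w|u w|u v] a x y /=;
  rewrite ?linearPl ?linearPr ?linearPl.
Qed.
HB.instance Definition _ U V W :=
  GRing.isLinear.Build K (U ⊗ (V ⊗ W))%type (U ⊗ V ⊗ W)%type *:%R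
    (@tassoc U V W) (@tassoc_linear U V W).

Lemma tassoc_tens U V W (u : U) (v : V) (w : W) :
  tassoc (u ⊗ (v ⊗ w)) = u ⊗ v ⊗ w.
Proof.
by apply: tlift3r_tens => [v' w'|u' w'|u' v'] a x y /=;
  rewrite ?linearPl ?linearPr ?linearPl.
Qed.

Section Permute.
Variable V : lmodType K.

(* Indices are shifted: the letter k of {1, 2, 3} is the ordinal k - 1. *)
Definition letter (k : nat) : 'I_3 := inord k.-1.

Definition tens3 (x : 'I_3 -> V) : V ⊗ V ⊗ V :=
  x (letter 1) ⊗ x (letter 2) ⊗ x (letter 3).

Definition tperm3 (s : 'S_3) : V ⊗ V ⊗ V -> V ⊗ V ⊗ V :=
  tlift3l (fun x y z => tens3 (fun i => tnth [tuple x; y; z] (s^-1%g i))).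

Let upd (x : 'I_3 -> V) j u i := if i == j then u else x i.

Let ltE : (letter 1 = ord0) * (letter 2 = fintype.lift ord0 ord0) * (letter 3 = ord_max).
Proof. by do !split; apply/val_inj; rewrite /= inordK. Qed.

Let tens3_upd (s : 'S_3) x j a u v :
  tens3 (fun i => upd x j (a *: u + v) (s^-1%g i)) =
  a *: tens3 (fun i => upd x j u (s^-1%g i))
    + tens3 (fun i => upd x j v (s^-1%g i)).
Proof.
have updE w i : upd x j w (s^-1%g i) = if i == s j then w else x (s^-1%g i).
  by rewrite /upd -[_ == j](inj_eq (@perm_inj _ s)) permKV.
rewrite /tens3 !updE !ltE.
by case: (s j) => [[|[|[|k]]] kP] //=; rewrite ?linearPl ?linearPr ?linearPl.
Qed.

Let tens3_eq (x y : 'I_3 -> V) : x =1 y -> tens3 x = tens3 y.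
Proof. by move=> xy; rewrite /tens3 !xy. Qed.

Let f (s : 'S_3) x y z := tens3 (fun i => tnth [tuple x; y; z] (s^-1%g i)).

Let f1 s y z : linear (fun x => f s x y z).
Proof.
move=> a u v; pose x0 := tnth [tuple 0; y; z].
have E x : f s x y z = tens3 (fun i => upd x0 ord0 x (s^-1%g i)).
  apply: tens3_eq => i; rewrite /upd /x0.
  by case: (s^-1%g i) => [[|[|[|k]]] kP] //; rewrite !(tnth_nth 0).
by rewrite !E tens3_upd.
Qed.

Let f2 s x z : linear (fun y => f s x y z).
Proof.
move=> a u v; pose x0 := tnth [tuple x; 0; z].
have E y : f s x y z = tens3 (fun i => upd x0 (fintype.lift ord0 ord0) y (s^-1%g i)).
  apply: tens3_eq => i; rewrite /upd /x0.
  by case: (s^-1%g i) => [[|[|[|k]]] kP] //; rewrite !(tnth_nth 0).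
by rewrite !E tens3_upd.
Qed.

Let f3 s x y : linear (fun z => f s x y z).
Proof.
move=> a u v; pose x0 := tnth [tuple x; y; 0].
have E z : f s x y z = tens3 (fun i => upd x0 ord_max z (s^-1%g i)).
  apply: tens3_eq => i; rewrite /upd /x0.
  by case: (s^-1%g i) => [[|[|[|k]]] kP] //; rewrite !(tnth_nth 0).
by rewrite !E tens3_upd.
Qed.

HB.instance Definition _ s :=
  GRing.isLinear.Build K (V ⊗ V ⊗ V)%type (V ⊗ V ⊗ V)%type *:%R (tperm3 s)
    (tlift3l_linear (f1 s) (f2 s) (f3 s)).

Lemma tperm3_tens (s : 'S_3) (x : 'I_3 -> V) :
  tperm3 s (tens3 x) = tens3 (fun i => x (s^-1%g i)).
Proof.
rewrite /tperm3 {1}/tens3 (tlift3l_tens (f1 s) (f2 s) (f3 s)).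
apply: tens3_eq => i; rewrite !ltE.
by case: (s^-1%g i) => [[|[|[|k]]] kP] //; rewrite (tnth_nth 0) /=;
  congr (x _); apply/val_inj.
Qed.

End Permute.

End TensorMaps.

(* The 3-cycle i |-> j |-> k |-> i on the letters 1, 2, 3; products of        *)
(* permutations are read from left to right.                                  *)
Definition cycle3 (i j k : nat) : 'S_3 :=
  (tperm (letter i) (letter j) * tperm (letter i) (letter k))%g.

Lemma cycle3_213 : [/\ cycle3 2 1 3 (letter 2) = letter 1,
  cycle3 2 1 3 (letter 1) = letter 3 & cycle3 2 1 3 (letter 3) = letter 2].
Proof.
by rewrite !permE /= !permE /=; split; apply/val_inj;
  rewrite -!val_eqE /= !inordK //= !inordK.
Qed.

Lemma cycle3_231 : [/\ cycle3 2 3 1 (letter 2) = letter 3,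
  cycle3 2 3 1 (letter 3) = letter 1 & cycle3 2 3 1 (letter 1) = letter 2].
Proof.
by rewrite !permE /= !permE /=; split; apply/val_inj;
  rewrite -!val_eqE /= !inordK //= !inordK.
Qed.

Record homCoalgebra (K : fieldType) := HomCoalgebra {
  hom_sort :> lmodType K;
  comul : {linear hom_sort -> (hom_sort ⊗ hom_sort)%type};
  twist : {linear hom_sort -> hom_sort}
}.

Definition coassociator (K : fieldType) (V : lmodType K)
    (beta : {linear V -> V}) (D : {linear V -> (V ⊗ V)%type}) : V -> V ⊗ V ⊗ V :=
  (tmap D beta \o D) \- (@tassoc K V V V \o (tmap beta D \o D)).

HB.instance Definition _ (K : fieldType) (V : lmodType K)
  (beta : {linear V -> V}) (D : {linear V -> (V ⊗ V)%type}) :=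
  GRing.Linear.on (coassociator beta D).

Definition comul_op (K : fieldType) (C : homCoalgebra K) : {linear C -> (C ⊗ C)%type} :=
  @tflip K C C \o comul C.

Definition comul_L (K : fieldType) (C : homCoalgebra K) : {linear C -> (C ⊗ C)%type} :=
  comul C \- comul_op C.

(* Main.v *)
From HB Require Import structures.
Require Import Defs.
From mathcomp Require Import all_boot all_fingroup all_algebra.
From mathcomp Require Import all_solvable.
Set Implicit Arguments.
Unset Strict Implicit.
Unset Printing Implicit Defensive.

Import GRing.Theory.
Local Open Scope ring_scope.

(** Write E for the sum of the operators Phi_s over the even permutations s
    and N for the alternating sum of all the Phi_s. As the even permutations
    of three letters are the identity and the two 3-cycles, the left-hand side
    of the identity is E applied to the coassociator of Delta_L, and the
    right-hand side is twice N applied to that of Delta. Since s |-> Phi_s is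
    an action, two rules connect them: E (1 - Phi_t) = N for t odd
    (even_sum_odd), and N Phi_t = sgn(t) N for every t (antisym_tperm3).

    Put G = Delta ⊗ beta and H = beta ⊗ Delta, seen as maps from V ⊗ V to the
    third tensor power, and let r be the 3-cycle (213). Replacing Delta by
    Delta_L = Delta - tau Delta inside G or H amounts to composing with
    1 - Phi_(12), respectively 1 - Phi_(23) (tmap_commutator_left and
    tmap_commutator_right), so E turns the coassociator of Delta_L into
      N (G Delta - G tau Delta - H Delta + H tau Delta).
    Flipping the argument exchanges G and H up to a rotation: G tau = Phi_r H
    and H tau = Phi_r^-1 G (tmap_tflip and tassoc_tmap_tflip). As r is even,
    N absorbs these rotations, and what remains is
    N (G Delta - H Delta - H Delta + G Delta), that is, twice N applied to the
    coassociator of Delta. *)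

(** * The action of the symmetric group on the third tensor power *)

Section PermutationAction.
Variables (K : fieldType) (V : lmodType K).
Implicit Types (s t : 'S_3) (w : (V ⊗ V ⊗ V)%type).

Lemma tens3_tuple (x y z : V) : x ⊗ y ⊗ z = tens3 (tnth [tuple x; y; z]).
Proof. by rewrite /tens3 !(tnth_nth x) /= !inordK. Qed.

Lemma tens3_ext (M : lmodType K) (g h : {linear (V ⊗ V ⊗ V)%type -> M}) :
  (forall x, g (tens3 x) = h (tens3 x)) -> g =1 h.
Proof.
move=> gh; apply: tensor_ext => p z.
elim/tensor_ind: p => [|a x y p IHp]; first by rewrite linear0l !linear0.
by rewrite linearPl !linearP /= IHp tens3_tuple gh.
Qed.

(** The order of composition comes from the convention that s * t applies s
    first: Phi_s puts x_(s^-1 i) in slot i, and Phi_t then puts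
    x_(s^-1 (t^-1 i)) there. *)
Lemma tperm3M s t w : tperm3 t (tperm3 s w) = tperm3 (s * t)%g w.
Proof.
move: w; apply: (@tens3_ext _ (tperm3 t \o tperm3 s) (tperm3 (s * t)%g)) => x /=.
by rewrite !tperm3_tens /tens3 invMg !permM.
Qed.

Lemma tperm3_1 w : tperm3 1%g w = w.
Proof.
move: w; apply: (@tens3_ext _ (tperm3 1%g) idfun) => x /=.
by rewrite tperm3_tens /tens3 invg1 !perm1.
Qed.

Definition antisym w := \sum_s (-1) ^+ odd_perm s *: tperm3 s w.

Definition even_sum w := \sum_(s | ~~ odd_perm s) tperm3 s w.

Lemma antisym_is_linear : linear antisym.
Proof.
move=> a u w; rewrite /antisym scaler_sumr -big_split; apply: eq_bigr => s _ /=.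
by rewrite linearP scalerDr !scalerA mulrC.
Qed.
HB.instance Definition _ :=
  GRing.isLinear.Build K (V ⊗ V ⊗ V)%type (V ⊗ V ⊗ V)%type *:%R antisym
    antisym_is_linear.

Lemma even_sum_is_linear : linear even_sum.
Proof.
move=> a u w; rewrite /even_sum scaler_sumr -big_split; apply: eq_bigr => s _ /=.
by rewrite linearP.
Qed.
HB.instance Definition _ :=
  GRing.isLinear.Build K (V ⊗ V ⊗ V)%type (V ⊗ V ⊗ V)%type *:%R even_sum
    even_sum_is_linear.

(** Translation by t permutes the summands and multiplies each sign by that
    of t. *)
Lemma antisym_tperm3 t w :
  antisym (tperm3 t w) = (-1) ^+ odd_perm t *: antisym w.
Proof.
rewrite /antisym [in RHS](reindex_inj (mulgI t)) scaler_sumr.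
apply: eq_bigr => s _.
by rewrite tperm3M scalerA odd_permM signr_addb mulrA -expr2 sqrr_sign mul1r.
Qed.

(** Translation by an odd t carries the even permutations onto the odd ones,
    so the subtracted half supplies the odd terms of the alternating sum. *)
Lemma even_sum_odd t w :
  odd_perm t -> even_sum (w - tperm3 t w) = antisym w.
Proof.
move=> ot; rewrite /antisym (bigID (fun s => odd_perm s)) /= addrC.
rewrite linearB /=; congr (_ + _).
  by apply: eq_bigr => s /negPf ->; rewrite scale1r.
rewrite [RHS](reindex_inj (mulgI t)) /= -sumrN.
rewrite (eq_bigl (fun s => odd_perm (t * s)%g)); last first.
  by move=> s; rewrite odd_permM ot.
by apply: eq_bigr => s ->; rewrite scaleN1r tperm3M.
Qed.

End PermutationAction.

(** * Even permutations of three letters *)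

Lemma letter_eq (i j : nat) :
  (0 < i <= 3)%N -> (0 < j <= 3)%N -> (letter i == letter j) = (i == j).
Proof. by case: i j => [|i] [|j] //= ? ?; rewrite -val_eqE /= !inordK. Qed.

Lemma letter_ind (P : 'I_3 -> Prop) :
  P (letter 1) -> P (letter 2) -> P (letter 3) -> forall i, P i.
Proof.
move=> P1 P2 P3 i.
by rewrite -[i]inord_val; case: i => [[|[|[|k]]]] // lt_k3.
Qed.

Lemma cycle3_231V : cycle3 2 3 1 = (cycle3 2 1 3)^-1%g.
Proof.
apply/permP; have [c2 c1 c3] := cycle3_213; have [d2 d3 d1] := cycle3_231.
apply: letter_ind; rewrite ?d1 ?d2 ?d3; apply: (@perm_inj _ (cycle3 2 1 3)).
all: by rewrite permKV ?c1 ?c2 ?c3.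
Qed.

Lemma odd_cycle3_213 : odd_perm (cycle3 2 1 3) = false.
Proof. by rewrite odd_permM !odd_tperm !letter_eq. Qed.

Lemma uniq_rotations : uniq [:: 1%g; cycle3 2 1 3; cycle3 2 3 1].
Proof.
have [_ c1 _] := cycle3_213; have [_ _ d1] := cycle3_231.
apply: (@map_uniq _ _ (fun s : 'S_3 => s (letter 1))).
by rewrite /= perm1 c1 d1 !inE !letter_eq.
Qed.

(** The alternating group has 3!/2 = 3 elements, as many as the list, so it is
    enough that the listed permutations are distinct and even. *)
Lemma even_perm3E s :
  ~~ odd_perm s = (s \in [:: 1%g; cycle3 2 1 3; cycle3 2 3 1]).
Proof.
have cardA :
    #|[:: 1%g; cycle3 2 1 3; cycle3 2 3 1]| = #|('Alt_('I_3))%g|.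
  rewrite (card_uniqP uniq_rotations); apply/eqP.
  by rewrite -(eqn_pmul2l (ltn0Sn 1)) card_Alt card_ord.
rewrite -Alt_even; apply/esym; move: s.
apply/(subset_cardP cardA)/subsetP => t.
rewrite Alt_even !inE cycle3_231V.
by case/or3P => /eqP ->; rewrite ?odd_permV ?odd_perm1 ?odd_cycle3_213.
Qed.

Lemma even_sum3 (K : fieldType) (V : lmodType K) (w : (V ⊗ V ⊗ V)%type) :
  even_sum w = w + tperm3 (cycle3 2 1 3) w + tperm3 (cycle3 2 3 1) w.
Proof.
rewrite /even_sum (eq_bigl _ _ even_perm3E) -(big_uniq _ uniq_rotations) /=.
by rewrite !big_cons big_nil tperm3_1 addr0 addrA.
Qed.

(** * Flips as permutations of the tensor slots *)

Section TensorSlots.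
Variables (K : fieldType) (V : lmodType K).

Lemma tflip_left (p : (V ⊗ V)%type) (z : V) :
  tflip p ⊗ z = tperm3 (tperm (letter 1) (letter 2)) (p ⊗ z).
Proof.
elim/tensor_ind: p => [|a x y p IHp]; first by rewrite linear0 !linear0l linear0.
rewrite linearP /= linearPl linearPl /= linearP /= IHp tflip_tens.
rewrite [x ⊗ y ⊗ z]tens3_tuple tperm3_tens /tens3 tpermV tpermL tpermR tpermD ?letter_eq //.
by rewrite !(tnth_nth x) /= !inordK.
Qed.

Lemma tflip_right (x : V) (p : (V ⊗ V)%type) :
  tassoc (x ⊗ tflip p) = tperm3 (tperm (letter 2) (letter 3)) (tassoc (x ⊗ p)).
Proof.
elim/tensor_ind: p => [|a y z p IHp]; first by rewrite linear0 !linear0r !linear0.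
rewrite linearP /= linearPr linearPr /= !linearP /= IHp tflip_tens !tassoc_tens.
rewrite [x ⊗ y ⊗ z]tens3_tuple tperm3_tens /tens3 tpermV tpermL tpermR tpermD ?letter_eq //.
by rewrite !(tnth_nth x) /= !inordK.
Qed.

(** On pure tensors, the rotation takes x ⊗ y ⊗ z to y ⊗ z ⊗ x, since (213)
    sends the letters 2, 3, 1 to 1, 2, 3. *)
Lemma rotate_right (x : V) (p : (V ⊗ V)%type) :
  p ⊗ x = tperm3 (cycle3 2 1 3) (tassoc (x ⊗ p)).
Proof.
elim/tensor_ind: p => [|a y z p IHp]; first by rewrite linear0l linear0r !linear0.
rewrite linearPl linearPr /= !linearP /= IHp tassoc_tens.
have [d2 d3 d1] := cycle3_231.
rewrite [x ⊗ y ⊗ z]tens3_tuple tperm3_tens /tens3 -cycle3_231V d1 d2 d3.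
by rewrite !(tnth_nth x) /= !inordK.
Qed.

Variables (beta : {linear V -> V}) (D : {linear V -> (V ⊗ V)%type}).

(** After a flip, D and beta act on each other's factor; the value differs
    from that of beta ⊗ D only in that the slot carrying beta comes last rather
    than first. *)
Lemma tmap_tflip q :
  tmap D beta (tflip q) = tperm3 (cycle3 2 1 3) (tassoc (tmap beta D q)).
Proof.
move: q; apply: (@tensor_ext _ _ _ _ (tmap D beta \o @tflip K V V)
  (tperm3 (cycle3 2 1 3) \o (@tassoc K V V V \o tmap beta D))) => u v /=.
by rewrite tflip_tens !tmap_tens rotate_right.
Qed.

Lemma tassoc_tmap_tflip q :
  tassoc (tmap beta D (tflip q)) = tperm3 (cycle3 2 3 1) (tmap D beta q).
Proof.
have tflipK : tflip (tflip q) = q.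
  move: q; apply: (@tensor_ext _ _ _ _ (@tflip K V V \o @tflip K V V) idfun).
  by move=> u v /=; rewrite !tflip_tens.
by rewrite -{2}tflipK tmap_tflip tperm3M cycle3_231V mulgV tperm3_1.
Qed.

Variable DL : {linear V -> (V ⊗ V)%type}.
Hypothesis DL_E : forall v, DL v = D v - tflip (D v).

Lemma tmap_commutator_left q :
  tmap DL beta q =
  tmap D beta q - tperm3 (tperm (letter 1) (letter 2)) (tmap D beta q).
Proof.
move: q; apply: (@tensor_ext _ _ _ _ (tmap DL beta)
  (tmap D beta \- (tperm3 (tperm (letter 1) (letter 2)) \o tmap D beta))).
by move=> u v /=; rewrite !tmap_tens DL_E linearBl /= tflip_left.
Qed.

Lemma tmap_commutator_right q :
  tassoc (tmap beta DL q) = tassoc (tmap beta D q)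
    - tperm3 (tperm (letter 2) (letter 3)) (tassoc (tmap beta D q)).
Proof.
move: q; apply: (@tensor_ext _ _ _ _ (@tassoc K V V V \o tmap beta DL)
  ((@tassoc K V V V \o tmap beta D) \- (tperm3 (tperm (letter 2) (letter 3)) \o
      (@tassoc K V V V \o tmap beta D)))).
by move=> u v /=; rewrite !tmap_tens DL_E linearBr linearB /= tflip_right.
Qed.

(** The factor 2 arises because each of the two halves of the coassociator of
    D is obtained twice: once directly, once from the other half evaluated on
    the flipped coproduct. *)
Lemma even_sum_coassociator x :
  even_sum (coassociator beta DL x) = 2 *: antisym (coassociator beta D x).
Proof.
rewrite /coassociator /= tmap_commutator_left tmap_commutator_right.
rewrite linearB /= !even_sum_odd ?odd_tperm ?letter_eq //.
rewrite DL_E !linearB /= tmap_tflip tassoc_tmap_tflip !antisym_tperm3.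
rewrite cycle3_231V odd_permV odd_cycle3_213 !scale1r.
by rewrite !scaler_nat !mulr2n opprK [X in _ + X = _]addrC addrACA opprD.
Qed.

End TensorSlots.

Theorem proposition2p5 (K : closedFieldType) (charK : [pchar K] =i pred0)
    (C : homCoalgebra K) :
  let cL := coassociator (twist C) (comul_L C) in
  let c := coassociator (twist C) (comul C) in
  forall x : C,
    cL x + tperm3 (cycle3 2 1 3) (cL x) + tperm3 (cycle3 2 3 1) (cL x) =
    2 *: \sum_(s : 'S_3) (-1) ^+ odd_perm s *: tperm3 s (c x).
Proof.
by move=> cL c x; rewrite -even_sum3 (@even_sum_coassociator _ _ _ (comul C)).
Qed.
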